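(* Let $n\ge 1$, let $\Omega_1,\dots,\Omega_n$ be finite nonempty sets with $m_i=\#\Omega_i$, let $\Omega=\Omega_1\times\cdots\times\Omega_n$, and let $1\le k\le n$. Let $\mathcal P^k$ be the set of all $k$-factor probability distributions on $\Omega$. Then the VC dimension of $\mathcal P^k$ (as a family of real-valued functions on $\Omega$) is at most $$h_k:=\sum_{\mathbf j} m_{j_1}m_{j_2}\cdots m_{j_k},$$ where $\mathbf j=\{j_1,\dots,j_k\}$ runs over all subsets of $\{1,\dots,n\}$ with $k$ elements.
   Context: $k$-factor distributions: $\mathcal P^k$ is the set of probability distributions $P$ on $\Omega$ of the form $P(x_1,\dots,x_n)=\prod_{\mathbf j} q_{\mathbf j}(x_{j_1},\dots,x_{j_k})$, where $\mathbf j=\{j_1<\dots<j_k\}$ runs over all $k$-element subsets of $\{1,\dots,n\}$ and each $q_{\mathbf j}:\Omega_{j_1}\times\cdots\times\Omega_{j_k}\to(0,\infty)$ is a (strictly) positive function (not necessarily a probability). VC dimension: for a family $(f_\alpha)_{\alpha\in\Lambda}$ of indicator functions $f_\alpha:\Omega\to\{0,1\}$, the VC dimension is the largest number $h$ such that there exist $h$ points $x_1,\dots,x_h\in\Omega$ with the property that every function $\chi:\{x_1,\dots,x_h\}\to\{0,1\}$ is the restriction of some $f_\alpha$. For a family $(f_\alpha)_{\alpha\in\Lambda}$ of real-valued functions on $\Omega$, the VC dimension is that of the family of indicator functions $(\chi_\mu\circ f_\alpha)_{\mu\in\mathbb R,\alpha\in\Lambda}$, where $\chi_\mu(t)=0$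 for $t<\mu$ and $\chi_\mu(t)=1$ for $t\ge\mu$. *)

(* Defs.v *)
From HB Require Import structures.
From mathcomp Require Import all_boot all_order all_algebra.
From mathcomp Require Import boolp classical_sets reals.

Set Implicit Arguments.
Unset Strict Implicit.
Unset Printing Implicit Defensive.

Import Order.TTheory GRing.Theory Num.Theory.

Local Open Scope ring_scope.
Local Open Scope classical_set_scope.

Section VCDimension.
Variable T : finType.

Definition shatters (F : set (T -> bool)) (S : {set T}) : Prop :=
  forall chi : T -> bool, exists2 f, F f & {in S, f =1 chi}.

(* A set of h distinct points is an S : {set T} with #|S| = h. For nonempty F
   the set S = set0 is shattered, so the maximum is attained; for empty F
   the value is 0 by convention. *)
Definition vc_dim (F : set (T -> bool)) : nat :=
  \max_(S : {set T} | `[< shatters F S >]) #|S|.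

Variable R : realType.

Definition thresholds (F : set (T -> R)) : set (T -> bool) :=
  [set g | exists mu : R, exists2 f, F f & g = (fun x => mu <= f x)].

Definition real_vc_dim (F : set (T -> R)) : nat := vc_dim (thresholds F).

Definition is_distribution (P : T -> R) : Prop :=
  (forall x, 0 <= P x) /\ \sum_x P x = 1.

End VCDimension.

Section KFactor.
Variables (R : realType) (n : nat) (Omega : 'I_n -> finType).

Definition state := {dffun forall i : 'I_n, Omega i}.

Definition substate (J : {set 'I_n}) :=
  {dffun forall i : {i : 'I_n | i \in J}, Omega (val i)}.

Definition proj_sub (J : {set 'I_n}) (x : state) : substate J :=
  [ffun i : {i : 'I_n | i \in J} => x (val i)].

Definition k_factor (k : nat) : set (state -> R) :=
  [set P | is_distribution P /\
     exists q : forall J : {set 'I_n}, substate J -> R,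
       (forall (J : {set 'I_n}) (y : substate J), #|J| = k -> 0 < q J y) /\
       (forall x, P x = \prod_(J : {set 'I_n} | #|J| == k) q J (proj_sub J x))].

End KFactor.

Arguments k_factor R {n} Omega k.

(* Main.v *)
(* Taking logarithms, the condition mu <= P x with mu > 0 becomes 0 <= v x for a
   function v in the span of the h_k indicators of cylinders {x | proj_sub J x = y},
   #|J| = k; this span contains the constants. The sets {0 <= v}, v in a vector
   space of dimension at most d, cannot shatter d + 1 points: some nontrivial linear
   relation holds between the evaluations at these points, and it forbids v to be
   nonnegative exactly where the coefficients of the relation are nonnegative. *)
Require Import Defs.
From mathcomp Require Import all_boot all_order all_algebra.
From mathcomp Require Import boolp classical_sets reals sequences exp.

Set Implicit Arguments.
Unset Strict Implicit.
Unset Printing Implicit Defensive.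

Import Order.TTheory GRing.Theory Num.Theory.

Local Open Scope ring_scope.

(** More rows than columns leave a nonzero vector in the left kernel; up to negation it has a
    negative entry. Strict negativity matters: entries that are nonnegative give no strict
    inequality later. *)
Lemma row_dependence (R : realFieldType) (m d : nat) (A : 'M[R]_(m, d)) :
  (d < m)%N -> exists2 v : 'rV[R]_m, v *m A = 0 & exists j, v 0 j < 0.
Proof.
move=> ltdm.
have /rowV0Pn[v /sub_kermxP vA0 v_neq0] : kermx A != 0.
  by rewrite -mxrank_eq0 mxrank_ker subn_eq0 -ltnNge (leq_ltn_trans (rank_leq_col A)).
have [j vj_neq0] : exists j, v 0 j != 0.
  by have /rV0Pn := v_neq0.
have [vj_lt0 | vj_gt0 | vj0] := ltgtP (v 0 j) 0.
- by exists v => //; exists j.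
- exists (- v); first by rewrite mulNmx vA0 oppr0.
  by exists j; rewrite mxE oppr_lt0.
- by rewrite vj0 eqxx in vj_neq0.
Qed.

Lemma vc_dim_le_span (R : realType) (T I : finType) (B : I -> T -> R)
    (F : set (T -> bool)) :
  (forall g, F g -> exists a : I -> R, forall x, g x = (0 <= \sum_i a i * B i x)) ->
  (vc_dim F <= #|I|)%N.
Proof.
move=> spanF; apply/bigmax_leqP => S /asboolP shS; rewrite leqNgt; apply/negP => ltIS.
have [v vA0 [j0 vj0_lt0]] :=
  @row_dependence R _ _ (\matrix_(j < #|S|, i < #|I|) B (enum_val i) (enum_val j)) ltIS.
(* [chi] is the sign pattern of [v] carried over to the points of [S]; outside [S] it is vacuously
   true. *)
pose chi x := [forall j : 'I_#|S|, (enum_val j == x) ==> (0 <= v 0 j)].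
have chiE j : chi (enum_val j) = (0 <= v 0 j).
  apply/forallP/idP => [/(_ j)|vj_ge0 i]; first by rewrite eqxx.
  by apply/implyP => /eqP/enum_val_inj ->.
have [g /spanF[a ga] gchi] := shS chi.
pose f (j : 'I_#|S|) := \sum_i a i * B i (enum_val j).
have fE j : (0 <= f j) = (0 <= v 0 j).
  by rewrite -ga gchi ?chiE // enum_valP.
have sum0 : \sum_j v 0 j * f j = 0.
  under eq_bigr do rewrite mulr_sumr.
  rewrite exchange_big big1 // => i _.
  have /matrixP/(_ 0 (enum_rank i)) := vA0; rewrite !mxE => eq0.
  under eq_bigr do rewrite mulrCA.
  rewrite -mulr_sumr -[RHS](mulr0 (a i)) -[in RHS]eq0; congr (_ * _).
  by apply: eq_bigr => j _; rewrite mxE enum_rankK.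
(* [f j] and [v 0 j] are negative for the same [j], so no product is negative, and the one at [j0]
   is positive although the sum is 0. *)
have term_ge0 j : 0 <= v 0 j * f j.
  have [vj_ge0 | vj_lt0] := leP 0 (v 0 j); first by rewrite mulr_ge0 // fE.
  by rewrite ltW // nmulr_rgt0 // ltNge fE -ltNge.
have term0 : v 0 j0 * f j0 = 0.
  exact: (psumr_eq0P (fun j _ => term_ge0 j) sum0).
have : 0 < v 0 j0 * f j0 by rewrite nmulr_rgt0 // ltNge fE -ltNge.
by rewrite term0 ltxx.
Qed.

Section KFactorSpan.
Variables (n : nat) (Omega : 'I_n -> finType) (k : nat).

(** The pair of [J] and [y] encodes the set of all [x] with [proj_sub J x = y]. *)
Definition cylinder :=
  {p : {J : {set 'I_n} & substate Omega J} | #|tag p| == k}.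

Lemma card_substate (J : {set 'I_n}) :
  #|{: substate Omega J}| = (\prod_(i in J) #|Omega i|)%N.
Proof. by rewrite card_dep_ffun foldrE big_image [RHS]big_sub. Qed.

Lemma big_cylinder (S : Type) (idx : S) (op : Monoid.com_law idx)
    (F : forall J : {set 'I_n}, substate Omega J -> S) :
  \big[op/idx]_(c : cylinder) F (tag (val c)) (tagged (val c))
  = \big[op/idx]_(J : {set 'I_n} | #|J| == k)
      \big[op/idx]_(y : substate Omega J) F J y.
Proof.
rewrite sig_big_dep.
rewrite -(big_sub [pred p : {J : {set 'I_n} & substate Omega J} | #|tag p| == k]
  (fun p => F (tag p) (tagged p))).
by apply: eq_bigl => p; rewrite andbT.
Qed.

Lemma card_cylinder :
  #|{: cylinder}| = (\sum_(J : {set 'I_n} | #|J| == k) \prod_(i in J) #|Omega i|)%N.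
Proof.
rewrite -sum1_card (big_cylinder _ (fun _ _ => 1%N)).
by apply: eq_bigr => J _; rewrite sum1_card card_substate.
Qed.

Lemma thresholds_k_factor_span (R : realType) (g : state Omega -> bool) :
  (k <= n)%N -> thresholds (k_factor R Omega k) g ->
  exists a : cylinder -> R, forall x,
    g x = (0 <= \sum_c a c * (tagged (val c) == proj_sub (tag (val c)) x)%:R).
Proof.
move=> lekn [mu [P [[P_ge0 _] [q [q_gt0 PE]]] ->]].
(* For [mu <= 0] there is no logarithm to take, but [P >= 0] makes the indicator constantly true, as
   the zero combination does. *)
have [mu_le0 | mu_gt0] := leP mu 0.
  exists (fun=> 0) => x; rewrite (le_trans mu_le0 (P_ge0 x)) big1 ?lexx // => c _.
  by rewrite mul0r.
(* Each of the N sets J carries an equal share of the constant [ln mu]. *)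
pose N := #|[set J : {set 'I_n} | #|J| == k]|.
have N_neq0 : N%:R != 0 :> R.
  by rewrite pnatr_eq0 /N card_draws card_ord -lt0n bin_gt0.
exists (fun c => ln (q (tag (val c)) (tagged (val c))) - ln mu / N%:R) => x.
rewrite (big_cylinder _ (fun J y => (ln (q J y) - ln mu / N%:R) * (y == proj_sub J x)%:R)).
(* For each [J], exactly one cylinder over [J] contains [x]. *)
under eq_bigr => J _.
  rewrite (bigD1 (proj_sub J x)) //= eqxx mulr1 big1 ?addr0 => [|y /negPf ->]; last first.
    by rewrite mulr0.
  over.
have PexpE : P x = expR (\sum_(J : {set 'I_n} | #|J| == k) ln (q J (proj_sub J x))).
  rewrite PE expR_sum; apply: eq_bigr => J /eqP Jk.
  by rewrite lnK // posrE q_gt0.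
rewrite sumrB sumr_const -cardsE -[_ / _ *+ _]mulr_natr divfK // subr_ge0.
by rewrite PexpE -[mu in LHS]lnK ?posrE // ler_expR.
Qed.

End KFactorSpan.

Theorem lemma2 (R : realType) (n : nat) (Omega : 'I_n -> finType) (k : nat)
    (hn : (1 <= n)%N) (hOmega : forall i, (0 < #|Omega i|)%N)
    (hk1 : (1 <= k)%N) (hkn : (k <= n)%N) :
  (real_vc_dim (k_factor R Omega k)
     <= \sum_(J : {set 'I_n} | #|J| == k) \prod_(i in J) #|Omega i|)%N.
Proof.
rewrite -card_cylinder; apply: vc_dim_le_span => g g_thr.
exact: thresholds_k_factor_span hkn g_thr.
Qed.
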